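(* Let $X$ be a proper and almost extendible CAT(0) space, let $\gamma$ be a hyperbolic isometry of $X$, and let $r$ be a reflection of $X$ with fixed-point set $F_r$. Suppose that (1) $\gamma^{\infty}\notin\partial F_r$, (2) $\gamma(\partial F_r)\subset\partial F_r$, and (3) $\operatorname{Min}(\gamma)\cap F_r=\emptyset$. Then the boundary $\partial X$ of $X$ is not locally connected.
   Context: A metric space is proper if every closed metric ball is compact. For a proper CAT(0) space $X$, $\partial X$ denotes its visual boundary (asymptotic classes of geodesic rays) with the cone topology; for a subset $A\subset X$, $\partial A\subset\partial X$ denotes the set of boundary points represented by geodesic rays contained in $A$. A CAT(0) space $X$ is almost extendible if there is a constant $M>0$ such that for every pair of points $x,y\in X$ there is a geodesic ray $\zeta:[0,\infty)\to X$ with $\zeta(0)=x$ that passes within distance $M$ of $y$. For an isometry $\gamma$ of $X$, its translation length is $|\gamma|=\inf\{d(x,\gamma x)\mid x\in X\}$ and $\operatorname{Min}(\gamma)=\{x\in X\mid d(x,\gamma x)=|\gamma|\}$; $\gamma$ is hyperbolic if $\operatorname{Min}(\gamma)\neq\emptyset$ and $|\gamma|>0$. For a hyperbolic isometry $\gamma$, $\gamma^\infty\in\partial X$ is the limit point of the sequence $\{\gamma^i x_0\}_i$ for $x_0\in X$. A reflection of a geodesic space $X$ is an isometry $r$ of $X$ such that (i) $r^2$ is the identity, (ii) $X\setminus F_r$ has exactly two connected components $X_r^+$ and $X_r^-$, each convex, where $F_r$ is the fixed-point set of $r$, and (iii) $rX_r^+=X_r^-$ (it is not required that $F_r$ have empty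 interior). *)

(* Defs.v *)
From Stdlib Require Import Reals List.
Open Scope R_scope.

Section Defs.
Context {X : Type} (d : X -> X -> R).

Definition is_metric : Prop :=
  (forall x y, 0 <= d x y) /\ (forall x y, d x y = 0 <-> x = y) /\
  (forall x y, d x y = d y x) /\ (forall x y z, d x z <= d x y + d y z).

Definition metric_open (U : X -> Prop) : Prop :=
  forall x, U x -> exists eps, 0 < eps /\ forall y, d x y < eps -> U y.

Definition compact_set (K : X -> Prop) : Prop :=
  forall (I : Type) (U : I -> X -> Prop),
    (forall i, metric_open (U i)) -> (forall x, K x -> exists i, U i x) ->
    exists l : list I, forall x, K x -> exists i, In i l /\ U i x.

Definition proper : Prop :=
  forall x rho, compact_set (fun y => d x y <= rho).

Definition geod_seg (g : R -> X) (x y : X) : Prop :=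
  g 0 = x /\ g (d x y) = y /\
  forall s t, 0 <= s <= d x y -> 0 <= t <= d x y -> d (g s) (g t) = Rabs (s - t).

Definition geodesic_space : Prop := forall x y, exists g, geod_seg g x y.

Definition edist (p q : R * R) : R :=
  sqrt ((fst p - fst q) ^ 2 + (snd p - snd q) ^ 2).
Definition interp (p q : R * R) (t : R) : R * R :=
  (fst p + t * (fst q - fst p), snd p + t * (snd q - snd p)).

Definition CAT0 : Prop :=
  is_metric /\ geodesic_space /\
  forall (x y z : X) (g1 g2 : R -> X), geod_seg g1 x y -> geod_seg g2 x z ->
  forall xb yb zb : R * R,
    edist xb yb = d x y -> edist xb zb = d x z -> edist yb zb = d y z ->
  forall s t, 0 <= s <= d x y -> 0 <= t <= d x z ->
    d (g1 s) (g2 t) <= edist (interp xb yb (s / d x y)) (interp xb zb (t / d x z)).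

(** geodesic rays [0,oo) -> X (values at negative times are irrelevant) *)
Definition geodesic_ray (c : R -> X) : Prop :=
  forall s t, 0 <= s -> 0 <= t -> d (c s) (c t) = Rabs (s - t).

Definition asymptotic (c c' : R -> X) : Prop :=
  exists C, forall t, 0 <= t -> d (c t) (c' t) <= C.

Definition almost_extendible : Prop :=
  exists M, 0 < M /\ forall x y, exists z, geodesic_ray z /\ z 0 = x /\
    exists t, 0 <= t /\ d (z t) y <= M.

Definition bdry : Type :=
  { P : (R -> X) -> Prop | exists c, geodesic_ray c /\ P = asymptotic c }.

Definition represents (xi : bdry) (c : R -> X) : Prop :=
  geodesic_ray c /\ proj1_sig xi c.

Definition bdry_of (A : X -> Prop) (xi : bdry) : Prop :=
  exists c, represents xi c /\ forall t, 0 <= t -> A (c t).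

Definition cone_open (x0 : X) (W : bdry -> Prop) : Prop :=
  forall xi, W xi -> exists r eps, 0 < r /\ 0 < eps /\
    forall eta, (exists c c', represents xi c /\ c 0 = x0 /\
                              represents eta c' /\ c' 0 = x0 /\
                              d (c r) (c' r) < eps) -> W eta.

Definition converges_to_bdry (x0 : X) (u : nat -> X) (xi : bdry) : Prop :=
  forall r eps, 0 < r -> 0 < eps -> exists N, forall n, (N <= n)%nat ->
    r < d x0 (u n) /\
    exists cn c, geod_seg cn x0 (u n) /\ represents xi c /\ c 0 = x0 /\
                 d (cn r) (c r) < eps.

Definition isometry (g : X -> X) : Prop :=
  (forall x y, d (g x) (g y) = d x y) /\ (forall y, exists x, g x = y).

Definition is_translation_length (g : X -> X) (l : R) : Prop :=
  (forall x, l <= d x (g x)) /\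
  (forall l', (forall x, l' <= d x (g x)) -> l' <= l).

Definition Min (g : X -> X) (x : X) : Prop :=
  exists l, is_translation_length g l /\ d x (g x) = l.

Definition hyperbolic (g : X -> X) : Prop :=
  isometry g /\ (exists x, Min g x) /\
  exists l, is_translation_length g l /\ 0 < l.

Definition is_gamma_infty (g : X -> X) (xi : bdry) : Prop :=
  forall x0, converges_to_bdry x0 (fun i => Nat.iter i g x0) xi.

Definition maps_bdry_into (g : X -> X) (A : X -> Prop) : Prop :=
  forall c, geodesic_ray c ->
    (exists c', geodesic_ray c' /\ asymptotic c c' /\ forall t, 0 <= t -> A (c' t)) ->
    (exists c', geodesic_ray c' /\ asymptotic (fun t => g (c t)) c' /\
                forall t, 0 <= t -> A (c' t)).

Definition connected_in {T : Type} (op : (T -> Prop) -> Prop) (A : T -> Prop) : Prop :=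
  ~ exists U V, op U /\ op V /\ (forall x, A x -> U x \/ V x) /\
      (exists x, A x /\ U x) /\ (exists x, A x /\ V x) /\
      (forall x, A x -> U x -> V x -> False).

Definition locally_connected {T : Type} (op : (T -> Prop) -> Prop) : Prop :=
  forall x U, op U -> U x ->
    exists V, op V /\ V x /\ (forall y, V y -> U y) /\ connected_in op V.

Definition is_component (Y C : X -> Prop) : Prop :=
  (forall x, C x -> Y x) /\ (exists x, C x) /\ connected_in metric_open C /\
  forall D, (forall x, D x -> Y x) -> connected_in metric_open D ->
    (exists x, C x /\ D x) -> forall x, D x -> C x.

Definition convex (C : X -> Prop) : Prop :=
  forall x y g, C x -> C y -> geod_seg g x y ->
    forall t, 0 <= t <= d x y -> C (g t).

Definition Fix (r : X -> X) (x : X) : Prop := r x = x.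

Definition reflection (r : X -> X) : Prop :=
  isometry r /\ (forall x, r (r x) = x) /\
  exists Xp Xm : X -> Prop,
    (exists x, Xp x /\ ~ Xm x) /\
    (forall C, is_component (fun x => ~ Fix r x) C <->
       ((forall x, C x <-> Xp x) \/ (forall x, C x <-> Xm x))) /\
    is_component (fun x => ~ Fix r x) Xp /\
    is_component (fun x => ~ Fix r x) Xm /\
    convex Xp /\ convex Xm /\
    (forall y, Xm y <-> exists x, Xp x /\ r x = y).

End Defs.

(* Main.v *)
(* Let [x] lie on an axis of [gam], on the side [P] of the wall [F = Fix r], let
   [N] be the other side and let [xi] be the class of the axis ray. Since [xi] is
   not in the boundary of [F], the axis goes arbitrarily far from [F], so its
   reflection gives a point [y] of [N] at distance more than [M] from [F]. By
   almost extendibility some ray from [x] passes within [M] of [gam^n y], hence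
   crosses [gam^n F] and never comes back; these rays pass at bounded distance from
   [gam^n x], so their endpoints converge to [xi]. A small connected neighbourhood
   of [xi] would avoid the boundary of [F], hence that of every [gam^n F], while
   [gam^n F] separates [xi] from the [n]-th endpoint. *)
Require Import Defs.
From Stdlib Require Import Reals Lra Lia List Classical ClassicalEpsilon.
Open Scope R_scope.

(** Hypothesis (3) controls the axis: [Min] contains the segment from each of its points to the
    image of that point, so no step of the orbit of [x], forwards or backwards, can change sides.
    Every orbit point then lies in [gam^n P] as well as in [P], and [xi] is never beyond [gam^n F].
    Hypothesis (2) lets one neighbourhood of [xi] serve for all [n], since the walls [gam^n F] have
    their boundaries inside that of [F]. The depth of [y] must exceed [M] because almost
    extendibility brings a ray only within [M] of its target: near a shallower target the ray could
    stay on the wrong side. The reflection copies distances to [F] from the side of the axis to the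
    other side. The cone topology is based at an arbitrary [x0] while the rays start at [x], so
    closeness of boundary points has to be carried from one base point to another. *)

(** * Real quotients and Euclidean comparison triangles *)

Lemma div_nonneg a b : 0 <= a -> 0 < b -> 0 <= a / b.
Proof.
  intros Ha Hb. apply Rmult_le_pos; [exact Ha |]. now apply Rlt_le, Rinv_0_lt_compat.
Qed.

Lemma div_le_of_le_mult a b c : 0 < b -> a <= c * b -> a / b <= c.
Proof.
  intros Hb H. apply Rmult_le_reg_r with b; [exact Hb |].
  replace (a / b * b) with a by (field; lra). exact H.
Qed.

Lemma div_lt_of_lt_mult a b c : 0 < b -> a < c * b -> a / b < c.
Proof.
  intros Hb H. apply Rmult_lt_reg_r with b; [exact Hb |].
  replace (a / b * b) with a by (field; lra). exact H.
Qed.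

Lemma div_unit_interval s t : 0 <= s <= t -> 0 < t -> 0 <= s / t <= 1.
Proof.
  intros Hs Ht. split; [apply div_nonneg | apply div_le_of_le_mult]; lra.
Qed.

(** The side [a] is laid on the first axis; the law of cosines then gives [u], the abscissa of the
    third vertex. *)
Lemma comparison_triangle (a b c : R) :
  0 < a -> 0 <= b -> 0 <= c -> c <= a + b -> a <= b + c -> b <= a + c ->
  exists xb yb zb, edist xb yb = a /\ edist xb zb = b /\ edist yb zb = c.
Proof.
  intros Ha Hb Hc H1 H2 H3.
  set (u := (a ^ 2 + b ^ 2 - c ^ 2) / (2 * a)).
  assert (Hu : 2 * a * u = a ^ 2 + b ^ 2 - c ^ 2) by (unfold u; field; lra).
  assert (Hub : 0 <= b ^ 2 - u ^ 2).
  (* Heron's formula: this is sixteen times the squared area, a product of four factors that the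
     triangle inequalities make nonnegative. *)
  { assert (H : 0 <= 4 * a ^ 2 * (b ^ 2 - u ^ 2)).
    { replace (4 * a ^ 2 * (b ^ 2 - u ^ 2))
        with ((2 * a * b - 2 * a * u) * (2 * a * b + 2 * a * u)) by ring.
      rewrite Hu.
      apply Rmult_le_pos.
      - replace (2 * a * b - (a ^ 2 + b ^ 2 - c ^ 2))
          with ((c - a + b) * (c + a - b)) by ring.
        apply Rmult_le_pos; lra.
      - replace (2 * a * b + (a ^ 2 + b ^ 2 - c ^ 2))
          with ((a + b - c) * (a + b + c)) by ring.
        apply Rmult_le_pos; lra. }
    apply Rmult_le_reg_l with (4 * a ^ 2); nra. }
  exists (0, 0), (a, 0), (u, sqrt (b ^ 2 - u ^ 2)).
  unfold edist; cbn [fst snd].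
  assert (Hs : sqrt (b ^ 2 - u ^ 2) ^ 2 = b ^ 2 - u ^ 2) by (apply pow2_sqrt, Hub).
  repeat split.
  - replace ((0 - a) ^ 2 + (0 - 0) ^ 2) with (a ^ 2) by ring. apply sqrt_pow2; lra.
  - replace ((0 - u) ^ 2 + (0 - sqrt (b ^ 2 - u ^ 2)) ^ 2) with (b ^ 2)
      by (ring_simplify; rewrite Hs; ring).
    apply sqrt_pow2; lra.
  - replace ((a - u) ^ 2 + (0 - sqrt (b ^ 2 - u ^ 2)) ^ 2) with (c ^ 2).
    + apply sqrt_pow2; lra.
    + ring_simplify. rewrite Hs. lra.
Qed.

Lemma edist_interp (x y z : R * R) (t : R) :
  0 <= t -> edist (interp x y t) (interp x z t) = t * edist y z.
Proof.
  intros Ht. unfold edist, interp; cbn [fst snd].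
  (* The fifth [t] is the scalar on the right; as a root it merges with the other one. *)
  rewrite <- (sqrt_pow2 t) at 5 by exact Ht.
  rewrite <- sqrt_mult_alt by nra. f_equal; ring.
Qed.

(** * Geodesics in CAT(0) spaces *)

Section CAT0.
Context {X : Type} {d : X -> X -> R} (Hcat : CAT0 d).

Lemma dist_nonneg x y : 0 <= d x y.
Proof. apply Hcat. Qed.

Lemma dist_sym x y : d x y = d y x.
Proof. apply Hcat. Qed.

Lemma dist_triangle y x z : d x z <= d x y + d y z.
Proof. apply Hcat. Qed.

Lemma dist_self x : d x x = 0.
Proof. now apply Hcat. Qed.

Lemma dist_zero x y : d x y <= 0 -> x = y.
Proof. intro H. apply Hcat. pose proof (dist_nonneg x y). lra. Qed.

Lemma geod_exists x y : exists g, geod_seg d g x y.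
Proof. apply Hcat. Qed.

Lemma geod_dist_start g x y t :
  geod_seg d g x y -> 0 <= t <= d x y -> d x (g t) = t.
Proof.
  intros (H0 & _ & H) Ht. rewrite <- H0 at 1. rewrite H by lra.
  rewrite Rabs_left1; lra.
Qed.

Lemma geod_dist_end g x y t :
  geod_seg d g x y -> 0 <= t <= d x y -> d (g t) y = d x y - t.
Proof.
  intros (_ & H1 & H) Ht. rewrite <- H1 at 1. rewrite H by lra.
  rewrite Rabs_left1; lra.
Qed.

Lemma geod_reverse g x y :
  geod_seg d g x y -> geod_seg d (fun s => g (d x y - s)) y x.
Proof.
  intros (H0 & H1 & H). unfold geod_seg. rewrite (dist_sym y x).
  repeat split.
  - now rewrite Rminus_0_r.
  - now rewrite Rminus_diag.
  - intros s t Hs Ht. rewrite H by lra.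
    rewrite <- Rabs_Ropp. f_equal; ring.
Qed.

Lemma geod_restrict g x y t :
  geod_seg d g x y -> 0 <= t <= d x y -> geod_seg d g x (g t).
Proof.
  intros Hg Ht. unfold geod_seg.
  rewrite (geod_dist_start g x y t) by assumption.
  destruct Hg as (H0 & H1 & H). repeat split; trivial.
  intros; apply H; lra.
Qed.

Lemma geod_isometry f g x y :
  isometry d f -> geod_seg d g x y -> geod_seg d (fun t => f (g t)) (f x) (f y).
Proof.
  intros [Hf _] (H0 & H1 & H). unfold geod_seg. rewrite Hf.
  rewrite H0, H1. repeat split; trivial. intros. rewrite Hf. now apply H.
Qed.

Lemma geod_ray c t :
  geodesic_ray d c -> 0 <= t -> geod_seg d c (c 0) (c t).
Proof.
  intros Hc Ht. assert (E : d (c 0) (c t) = t).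
  { rewrite Hc by lra. rewrite Rabs_left1; lra. }
  unfold geod_seg. rewrite E. repeat split. intros; apply Hc; lra.
Qed.

Lemma ray_shift c a :
  geodesic_ray d c -> 0 <= a -> geodesic_ray d (fun t => c (a + t)).
Proof.
  intros Hc Ha s t Hs Ht. rewrite Hc by lra. f_equal; ring.
Qed.

(* Busemann convexity; this is the only consequence of the CAT(0) inequality
   that the rest of the argument uses. *)
Lemma geod_contract g1 g2 x y z l :
  geod_seg d g1 x y -> geod_seg d g2 x z -> 0 <= l <= 1 ->
  d (g1 (l * d x y)) (g2 (l * d x z)) <= l * d y z.
Proof.
  intros H1 H2 Hl.
  pose proof (dist_nonneg x y) as Pxy. pose proof (dist_nonneg x z) as Pxz.
  (* The comparison parameters are quotients by [d x y] and [d x z], so degenerate sides are treated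
     apart. *)
  destruct (Req_dec (d x y) 0) as [E | E].
  { assert (x = y) by (apply dist_zero; lra); subst y.
    rewrite E, Rmult_0_r. destruct H1 as [-> _].
    rewrite (geod_dist_start g2 x z); [lra | assumption | nra]. }
  destruct (Req_dec (d x z) 0) as [E' | E'].
  { assert (x = z) by (apply dist_zero; lra); subst z.
    rewrite E', Rmult_0_r. destruct H2 as [-> _]. rewrite dist_sym.
    rewrite (geod_dist_start g1 x y); [| assumption | nra].
    rewrite (dist_sym y x). lra. }
  pose proof (dist_nonneg y z).
  pose proof (dist_triangle x y z) as T1. rewrite (dist_sym y x) in T1.
  pose proof (dist_triangle z x y) as T2. rewrite (dist_sym z y) in T2.
  pose proof (dist_triangle y x z) as T3.
  destruct (comparison_triangle (d x y) (d x z) (d y z))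
    as (xb & yb & zb & E1 & E2 & E3); try lra.
  assert (Hlxy : 0 <= l * d x y <= d x y) by nra.
  assert (Hlxz : 0 <= l * d x z <= d x z) by nra.
  eapply Rle_trans.
  { exact (proj2 (proj2 Hcat) x y z g1 g2 H1 H2 xb yb zb E1 E2 E3 _ _ Hlxy Hlxz). }
  replace (l * d x y / d x y) with l by (field; lra).
  replace (l * d x z / d x z) with l by (field; lra).
  rewrite edist_interp by lra. rewrite E3. lra.
Qed.

Lemma geod_unique g1 g2 x y t :
  geod_seg d g1 x y -> geod_seg d g2 x y -> 0 <= t <= d x y -> g1 t = g2 t.
Proof.
  intros H1 H2 Ht. destruct (Req_dec (d x y) 0) as [E | E].
  { assert (t = 0) by lra; subst t. destruct H1 as [-> _], H2 as [-> _]. reflexivity. }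
  apply dist_zero.
  replace t with (t / d x y * d x y) by (field; lra).
  pose proof (geod_contract g1 g2 x y y (t / d x y) H1 H2) as H.
  rewrite dist_self, Rmult_0_r in H. apply H. apply div_unit_interval; lra.
Qed.

(** Contraction compares points at equal proportions; passing to equal times costs at most
    [l * d y z] more, whence the factor 2. *)
Lemma geod_fellow g1 g2 x y z t :
  geod_seg d g1 x y -> geod_seg d g2 x z ->
  0 <= t -> t <= d x y -> t <= d x z -> 0 < d x z ->
  d (g1 t) (g2 t) <= t / d x z * (2 * d y z).
Proof.
  intros H1 H2 Ht Hy Hz Hp.
  set (l := t / d x z).
  assert (El : l * d x z = t) by (unfold l; field; lra).
  assert (Hl : 0 <= l <= 1).
  { apply div_unit_interval; lra. }
  assert (A : d (g1 (l * d x y)) (g2 t) <= l * d y z).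
  { rewrite <- El. now apply geod_contract. }
  assert (B : d (g1 t) (g1 (l * d x y)) <= l * d y z).
  { pose proof (dist_nonneg x y).
    destruct H1 as (_ & _ & H1). rewrite H1 by (try nra; lra).
    rewrite <- El, <- Rmult_minus_distr_l, Rabs_mult, (Rabs_pos_eq l) by lra.
    apply Rmult_le_compat_l; [lra |].
    pose proof (dist_triangle y x z). pose proof (dist_triangle z x y).
    rewrite (dist_sym z y) in *. apply Rabs_le; lra. }
  pose proof (dist_triangle (g1 (l * d x y)) (g1 t) (g2 t)). lra.
Qed.

Lemma geod_concat x y z g h :
  geod_seg d g x y -> geod_seg d h y z -> d x y + d y z = d x z ->
  geod_seg d (fun t => if Rle_dec t (d x y) then g t else h (t - d x y)) x z.
Proof.
  intros Hg Hh E.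
  pose proof (dist_nonneg x y). pose proof (dist_nonneg y z).
  (* The upper bound goes through [y]; a smaller distance would give a path from [x] to [z] shorter
     than [d x z]. *)
  assert (main : forall s t, 0 <= s <= d x y -> d x y < t <= d x z ->
            d (g s) (h (t - d x y)) = t - s).
  { intros s t Hs Ht.
    pose proof (geod_dist_start g x y s Hg Hs).
    pose proof (geod_dist_end g x y s Hg Hs).
    pose proof (geod_dist_start h y z (t - d x y) Hh ltac:(lra)).
    pose proof (geod_dist_end h y z (t - d x y) Hh ltac:(lra)).
    pose proof (dist_triangle y (g s) (h (t - d x y))).
    pose proof (dist_triangle (g s) x z).
    pose proof (dist_triangle (h (t - d x y)) (g s) z). lra. }
  destruct Hg as (g0 & g1 & Hg), Hh as (h0 & h1 & Hh).
  repeat split.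
  - destruct (Rle_dec 0 (d x y)); [assumption | lra].
  - destruct (Rle_dec (d x z) (d x y)).
    + assert (y = z) by (apply dist_zero; lra). subst z. exact g1.
    + replace (d x z - d x y) with (d y z) by lra. exact h1.
  - intros s t Hs Ht.
    destruct (Rle_dec s (d x y)), (Rle_dec t (d x y)).
    + apply Hg; lra.
    + rewrite main by lra. rewrite Rabs_left1; lra.
    + rewrite dist_sym, main by lra. rewrite Rabs_pos_eq; lra.
    + rewrite Hh by lra. f_equal; ring.
Qed.

(** The concatenation through [y] is a geodesic, so by uniqueness it is [g]. *)
Lemma geod_through g x y z :
  geod_seg d g x z -> d x y + d y z = d x z -> g (d x y) = y.
Proof.
  intros Hg E.
  destruct (geod_exists x y) as [h1 H1]. destruct (geod_exists y z) as [h2 H2].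
  pose proof (geod_concat x y z h1 h2 H1 H2 E) as H.
  pose proof (dist_nonneg x y). pose proof (dist_nonneg y z).
  rewrite (geod_unique _ _ x z (d x y) Hg H) by lra.
  destruct (Rle_dec (d x y) (d x y)); [apply H1 | lra].
Qed.

(** * Asymptotic rays *)

Lemma asymptotic_sym c c' : asymptotic d c c' -> asymptotic d c' c.
Proof. intros [C H]. exists C. intros. rewrite dist_sym. auto. Qed.

Lemma asymptotic_trans c1 c2 c3 :
  asymptotic d c1 c2 -> asymptotic d c2 c3 -> asymptotic d c1 c3.
Proof.
  intros [C H] [C' H']. exists (C + C'). intros t Ht.
  specialize (H t Ht). specialize (H' t Ht).
  pose proof (dist_triangle (c2 t) (c1 t) (c3 t)). lra.
Qed.

(** A bounded convex function on a half-line cannot increase. Convexity comes from the diagonal from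
    [c 0] to [c' T], which cuts the quadrilateral into two triangles, each contracted from one end
    of the diagonal. *)
Lemma asymptotic_dist c c' t :
  geodesic_ray d c -> geodesic_ray d c' -> asymptotic d c c' -> 0 <= t ->
  d (c t) (c' t) <= d (c 0) (c' 0).
Proof.
  intros Hc Hc' [C HC] Ht. apply Rle_plus_epsilon. intros eps He.
  assert (C0 : 0 <= C) by (eapply Rle_trans; [apply dist_nonneg | apply (HC 0); lra]).
  (* So far out that the far side, of length at most [C], contributes at most [eps] after scaling by
     [t / T]. *)
  set (T := t + 1 + t * C / eps).
  assert (Q : 0 <= t * C / eps) by (apply div_nonneg; nra).
  assert (HT : 0 < T) by (unfold T; lra).
  assert (HtT : t <= T) by (unfold T; lra).
  set (l := t / T).
  assert (El : l * T = t) by (unfold l; field; lra).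
  assert (Hl : 0 <= l <= 1).
  { apply div_unit_interval; lra. }
  assert (HlC : l * C <= eps).
  { apply Rmult_le_reg_r with T; [exact HT |].
    replace (l * C * T) with (t * C) by (rewrite <- El; ring).
    replace (t * C) with (eps * (t * C / eps)) by (field; lra).
    apply Rmult_le_compat_l; unfold T; lra. }
  destruct (geod_exists (c 0) (c' T)) as [g Hg].
  pose proof (geod_ray c T Hc ltac:(lra)) as Gc.
  pose proof (geod_ray c' T Hc' ltac:(lra)) as Gc'.
  assert (E : d (c 0) (c T) = T) by (rewrite Hc by lra; rewrite Rabs_left1; lra).
  assert (E' : d (c' 0) (c' T) = T) by (rewrite Hc' by lra; rewrite Rabs_left1; lra).
  pose proof (geod_contract _ _ _ _ _ l Gc Hg Hl) as A.
  rewrite E, El in A.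
  pose proof (geod_contract _ _ _ _ _ (1 - l) (geod_reverse _ _ _ Hg)
                (geod_reverse _ _ _ Gc') ltac:(lra)) as B.
  cbv beta in B.
  rewrite (dist_sym (c' T) (c' 0)), (dist_sym (c' T) (c 0)), E' in B.
  replace (T - (1 - l) * T) with t in B by lra.
  replace (d (c 0) (c' T) - (1 - l) * d (c 0) (c' T)) with (l * d (c 0) (c' T)) in B by ring.
  pose proof (dist_triangle (g (l * d (c 0) (c' T))) (c t) (c' t)).
  pose proof (HC T ltac:(lra)). pose proof (dist_nonneg (c 0) (c' 0)). nra.
Qed.

Lemma ray_contract c c' s t :
  geodesic_ray d c -> geodesic_ray d c' -> c 0 = c' 0 -> 0 <= s <= t -> 0 < t ->
  d (c s) (c' s) <= s / t * d (c t) (c' t).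
Proof.
  intros Hc Hc' E Hs Ht.
  pose proof (geod_ray c t Hc ltac:(lra)) as Gc.
  pose proof (geod_ray c' t Hc' ltac:(lra)) as Gc'. rewrite <- E in Gc'.
  assert (D : d (c 0) (c t) = t) by (rewrite Hc by lra; rewrite Rabs_left1; lra).
  assert (D' : d (c 0) (c' t) = t) by (rewrite E, Hc' by lra; rewrite Rabs_left1; lra).
  pose proof (geod_contract _ _ _ _ _ (s / t) Gc Gc') as H.
  rewrite D, D' in H. replace (s / t * t) with s in H by (field; lra).
  apply H. apply div_unit_interval; lra.
Qed.

(** * Rays in proper spaces *)

Section Proper.
Context (Hprop : proper d).

(** Completeness from compactness by covers: without a limit, every point has a ball that a tail of
    [u] avoids, and finitely many such balls would cover a ball containing a tail. *)
Lemma cauchy_converges (u : nat -> X) :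
  (forall eps, 0 < eps -> exists N, forall n m, (N <= n)%nat -> (N <= m)%nat ->
     d (u n) (u m) < eps) ->
  exists y, forall eps, 0 < eps -> exists N, forall n, (N <= n)%nat -> d (u n) y < eps.
Proof.
  intros Hu. destruct (Hu 1 ltac:(lra)) as [N0 HN0].
  apply NNPP. intros Hno.
  assert (Hfar : forall y, exists e N, 0 < e /\ forall n, (N <= n)%nat -> e <= d y (u n)).
  { intros y. apply NNPP. intros Hy. apply Hno. exists y. intros eps He.
    destruct (Hu (eps / 2) ltac:(lra)) as [N HN]. exists N. intros n Hn.
    apply Rnot_le_lt. intros Hle. apply Hy. exists (eps / 2), N.
    split; [lra |]. intros m Hm. specialize (HN n m Hn Hm).
    pose proof (dist_triangle (u m) (u n) y). rewrite (dist_sym (u m) y) in *. lra. }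
  (* Indices are all triples of centre, radius and threshold; a triple whose ball is not avoided
     from the threshold on yields the empty set. *)
  destruct (Hprop (u N0) 1 (X * R * nat)%type
    (fun i z => d (fst (fst i)) z < snd (fst i) /\
       forall n, (snd i <= n)%nat -> snd (fst i) <= d (fst (fst i)) (u n)))
    as [L HL].
  - intros [[y e] N] z [Hz HN]; simpl in *. exists (e - d y z).
    split; [lra |]. intros w Hw. split; [| exact HN].
    pose proof (dist_triangle z y w). lra.
  - intros z _. destruct (Hfar z) as (e & N & He & HN). exists (z, e, N); simpl.
    rewrite dist_self. auto.
  - set (n := Nat.max N0 (list_max (map snd L))).
    destruct (HL (u n)) as (i & Hi & Hlt & Hge).
    + apply Rlt_le, HN0; unfold n; lia.
    + assert (snd i <= n)%nat.
      { transitivity (list_max (map snd L)); [| unfold n; lia].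
        pose proof (proj1 (list_max_le (map snd L) _) (le_n _)) as Hall.
        rewrite Forall_forall in Hall. apply Hall, in_map, Hi. }
      specialize (Hge n ltac:(assumption)). lra.
Qed.

(** Both geodesics end at [c m], so they are contracted from that common end. *)
Lemma ray_toward_segment c p g m t :
  geodesic_ray d c -> geod_seg d g p (c m) -> 0 <= t <= m -> 0 < m ->
  d (c t) (g (t / m * d p (c m))) <= d p (c 0).
Proof.
  intros Hc Hg Ht Hm.
  pose proof (geod_ray c m Hc ltac:(lra)) as Gc.
  assert (E : d (c 0) (c m) = m) by (rewrite Hc by lra; rewrite Rabs_left1; lra).
  assert (Hl : 0 <= t / m <= 1).
  { apply div_unit_interval; lra. }
  pose proof (geod_contract _ _ _ _ _ (1 - t / m) (geod_reverse _ _ _ Gc)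
                (geod_reverse _ _ _ Hg) ltac:(lra)) as B.
  cbv beta in B.
  rewrite (dist_sym (c m) (c 0)), (dist_sym (c m) p), E in B.
  replace (m - (1 - t / m) * m) with t in B by (field; lra).
  replace (d p (c m) - (1 - t / m) * d p (c m)) with (t / m * d p (c m)) in B by ring.
  rewrite (dist_sym (c 0) p) in B. pose proof (dist_nonneg p (c 0)). nra.
Qed.

Lemma ray_dist_from c p t :
  geodesic_ray d c -> 0 <= t -> t - d p (c 0) <= d p (c t) <= t + d p (c 0).
Proof.
  intros Hc Ht.
  assert (E : d (c 0) (c t) = t) by (rewrite Hc by lra; rewrite Rabs_left1; lra).
  pose proof (dist_triangle p (c 0) (c t)). pose proof (dist_triangle (c 0) p (c t)).
  rewrite (dist_sym (c 0) p) in *. lra.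
Qed.

(** The point [z] at proportion [n / m] on the longer segment lies within [D] of [c n], so the
    segments from [p] to [z] and to [c n] fellow-travel. *)
Lemma segments_to_ray_close c p g h n m t :
  geodesic_ray d c -> geod_seg d g p (c n) -> geod_seg d h p (c m) ->
  0 <= t -> t + 2 * d p (c 0) < n -> n <= m ->
  d (g t) (h t) <= t / (n - d p (c 0)) * (2 * d p (c 0)).
Proof.
  intros Hc Hg Hh Ht Hn Hm. set (D := d p (c 0)) in *.
  assert (D0 : 0 <= D) by apply dist_nonneg.
  pose proof (ray_dist_from c p n Hc ltac:(lra)) as Rn.
  pose proof (ray_dist_from c p m Hc ltac:(lra)) as Rm. fold D in Rn, Rm.
  set (l := n / m). set (z := h (l * d p (c m))).
  assert (Hl : 0 <= l <= 1).
  { apply div_unit_interval; lra. }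
  assert (Hz : d (c n) z <= D) by (apply ray_toward_segment; trivial; lra).
  assert (Hr : 0 <= l * d p (c m) <= d p (c m)) by nra.
  pose proof (geod_restrict h p (c m) _ Hh Hr) as Gz. fold z in Gz.
  assert (Hpz : n - 2 * D <= d p z).
  { pose proof (dist_triangle z p (c n)). rewrite (dist_sym z (c n)) in *. lra. }
  rewrite dist_sym. eapply Rle_trans.
  { apply (geod_fellow h g p z (c n)); trivial; lra. }
  rewrite (dist_sym z (c n)).
  pose proof (dist_nonneg (c n) z).
  apply Rmult_le_compat; try lra.
  - apply div_nonneg; lra.
  - unfold Rdiv. apply Rmult_le_compat_l; [lra |]. apply Rinv_le_contravar; lra.
Qed.

(** The ray is the pointwise limit of the segments from [p] to [c n]; these are Cauchy at each time,
    so completeness replaces an extraction of subsequences. *)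
Lemma ray_from c p :
  geodesic_ray d c ->
  exists c', geodesic_ray d c' /\ c' 0 = p /\ asymptotic d c c'.
Proof.
  intros Hc. set (D := d p (c 0)). assert (D0 : 0 <= D) by apply dist_nonneg.
  set (s := fun n : nat =>
    proj1_sig (constructive_indefinite_description _ (geod_exists p (c (INR n))))).
  assert (Hs : forall n, geod_seg d (s n) p (c (INR n))).
  { intros n. unfold s. now destruct constructive_indefinite_description. }
  assert (Hlen : forall n, INR n - D <= d p (c (INR n)) <= INR n + D).
  { intros n. apply ray_dist_from; [exact Hc | apply pos_INR]. }
  assert (large : forall a, exists N, forall n, (N <= n)%nat -> a < INR n).
  { intros a. destruct (INR_archimed 1 a ltac:(lra)) as [N HN]. exists N.
    intros n Hn. apply le_INR in Hn. lra. }
  (* The condition [0 <= t] sits under the existential so that choice gives a total function;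
     negative times get the value [p]. *)
  assert (Hlim : forall t, exists y, 0 <= t ->
            forall eps, 0 < eps -> exists N, forall n, (N <= n)%nat -> d (s n t) y < eps).
  { intros t. destruct (Rle_dec 0 t) as [Ht | Ht]; [| exists p; lra].
    destruct (cauchy_converges (fun n => s n t)) as [y Hy].
    - intros eps He.
      destruct (large (t + 2 * D + D + 1 + t * (2 * D) / eps)) as [N HN].
      exists N.
      assert (Q : 0 <= t * (2 * D) / eps) by (apply div_nonneg; nra).
      assert (H : forall n m, (N <= n)%nat -> (n <= m)%nat -> d (s n t) (s m t) < eps).
      { intros n m Hn Hm. specialize (HN n Hn). apply le_INR in Hm.
        eapply Rle_lt_trans.
        - apply (segments_to_ray_close c p _ _ (INR n) (INR m)); trivial; fold D; lra.
        - fold D. replace (t / (INR n - D) * (2 * D)) with (t * (2 * D) / (INR n - D))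
            by (field; lra).
          apply div_lt_of_lt_mult; [lra |].
          replace (t * (2 * D)) with (eps * (t * (2 * D) / eps)) by (field; lra).
          apply Rmult_lt_compat_l; lra. }
      intros n m Hn Hm. destruct (Nat.le_ge_cases n m).
      + now apply H.
      + rewrite dist_sym. now apply H.
    - exists y. auto. }
  set (c' := fun t => proj1_sig (constructive_indefinite_description _ (Hlim t))).
  assert (Hc' : forall t, 0 <= t -> forall eps, 0 < eps ->
            exists N, forall n, (N <= n)%nat -> d (s n t) (c' t) < eps).
  { intros t. unfold c'. now destruct constructive_indefinite_description. }
  clearbody c'.
  exists c'. repeat split.
  - intros t u Ht Hu. apply cond_eq. intros eps He.
    destruct (Hc' t Ht (eps / 2) ltac:(lra)) as [N1 HN1].
    destruct (Hc' u Hu (eps / 2) ltac:(lra)) as [N2 HN2].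
    destruct (large (t + u + D)) as [N3 HN3].
    set (n := Nat.max N1 (Nat.max N2 N3)).
    specialize (HN1 n ltac:(lia)). specialize (HN2 n ltac:(lia)). specialize (HN3 n ltac:(lia)).
    specialize (Hlen n). destruct (Hs n) as (_ & _ & E). specialize (E t u ltac:(lra) ltac:(lra)).
    rewrite <- E.
    pose proof (dist_triangle (s n t) (c' t) (c' u)).
    pose proof (dist_triangle (s n u) (s n t) (c' u)).
    pose proof (dist_triangle (c' t) (s n t) (s n u)).
    pose proof (dist_triangle (c' u) (c' t) (s n u)).
    rewrite (dist_sym (c' t) (s n t)), (dist_sym (c' u) (s n u)) in *.
    apply Rabs_def1; lra.
  - symmetry. apply dist_zero. apply Rle_plus_epsilon. intros eps He.
    destruct (Hc' 0 ltac:(lra) eps He) as [N HN]. specialize (HN N (le_n _)).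
    destruct (Hs N) as [E _]. rewrite E in HN. lra.
  (* One [D] compares points at equal proportions, the other corrects the parametrisation. *)
  - exists (2 * D). intros t Ht. apply Rle_plus_epsilon. intros eps He.
    destruct (Hc' t Ht eps He) as [N1 HN1]. destruct (large (t + D)) as [N2 HN2].
    set (n := Nat.max N1 N2).
    specialize (HN1 n ltac:(lia)). specialize (HN2 n ltac:(lia)). specialize (Hlen n).
    pose proof (ray_toward_segment c p (s n) (INR n) t Hc (Hs n) ltac:(lra) ltac:(lra)) as B.
    fold D in B. set (l := t / INR n) in *.
    assert (El : l * INR n = t) by (unfold l; field; lra).
    assert (Hl : 0 <= l <= 1).
    { apply div_unit_interval; lra. }
    assert (A : d (s n (l * d p (c (INR n)))) (s n t) <= D).
    { destruct (Hs n) as (_ & _ & E). rewrite E by (try nra; lra).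
      rewrite <- El, <- Rmult_minus_distr_l, Rabs_mult, (Rabs_pos_eq l) by lra.
      assert (Rabs (d p (c (INR n)) - INR n) <= D) by (apply Rabs_le; lra).
      pose proof (Rabs_pos (d p (c (INR n)) - INR n)). nra. }
    pose proof (dist_triangle (s n (l * d p (c (INR n)))) (c t) (s n t)).
    pose proof (dist_triangle (s n t) (c t) (c' t)). lra.
Qed.


(** * The cone topology *)

Definition enters (p : X) (O : X -> Prop) (eta : bdry d) : Prop :=
  exists c t, represents d eta c /\ c 0 = p /\ 0 <= t /\ O (c t).

Lemma represents_asymptotic eta c c' :
  represents d eta c -> represents d eta c' -> asymptotic d c c'.
Proof.
  destruct eta as [P (c0 & Hc0 & ->)]. intros [_ H] [_ H']. simpl in *.
  apply asymptotic_trans with c0; [apply asymptotic_sym |]; trivial.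
Qed.

Lemma represents_transfer eta c c' :
  represents d eta c -> geodesic_ray d c' -> asymptotic d c c' -> represents d eta c'.
Proof.
  destruct eta as [P (c0 & Hc0 & ->)]. intros [_ H] Hc' Ha. split; [exact Hc' |].
  simpl in *. now apply asymptotic_trans with c.
Qed.

Lemma ray_represents c : geodesic_ray d c -> exists eta, represents d eta c.
Proof.
  intros Hc. exists (exist _ (asymptotic d c) (ex_intro _ c (conj Hc eq_refl))).
  split; [exact Hc |]. exists 0. intros. rewrite dist_self. lra.
Qed.

Lemma represents_from eta p : exists c, represents d eta c /\ c 0 = p.
Proof.
  assert (exists c0, represents d eta c0) as [c0 H0].
  { destruct eta as [P (c0 & Hc0 & ->)]. exists c0. split; [exact Hc0 |].
    exists 0. intros. rewrite dist_self. lra. }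
  destruct (ray_from c0 p (proj1 H0)) as (c & Hc & E & Ha).
  exists c. split; [| exact E]. now apply represents_transfer with c0.
Qed.

Lemma represents_unique eta c c' t :
  represents d eta c -> represents d eta c' -> c 0 = c' 0 -> 0 <= t -> c t = c' t.
Proof.
  intros H H' E Ht. apply dist_zero.
  pose proof (asymptotic_dist c c' t (proj1 H) (proj1 H')
                (represents_asymptotic eta c c' H H') Ht) as B.
  now rewrite <- E, dist_self in B.
Qed.

(** Moving both rays from [q] to [p] costs [D] each, so closeness 1 at time [T] becomes [2 * D + 1];
    contraction towards [p] then scales this by [t / T], and [T] is chosen to bring it below
    [eps]. *)
Lemma cone_topology_base_change p q t eps :
  0 <= t -> 0 < eps -> exists T, 0 < T /\
    forall xi eta c c' b b', represents d xi c -> represents d eta c' ->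
      c 0 = p -> c' 0 = p -> represents d xi b -> represents d eta b' ->
      b 0 = q -> b' 0 = q -> d (b T) (b' T) < 1 -> d (c t) (c' t) < eps.
Proof.
  intros Ht He. set (D := d p q). assert (D0 : 0 <= D) by apply dist_nonneg.
  set (Q := t * (2 * D + 1) / eps).
  assert (Q0 : 0 <= Q) by (apply div_nonneg; nra).
  exists (t + 1 + Q). split; [lra |].
  intros xi eta c c' b b' Hc Hc' Ec Ec' Hb Hb' Eb Eb' Hlt.
  set (T := t + 1 + Q) in *. assert (HT : T = t + 1 + Q) by reflexivity.
  assert (A : d (c T) (b T) <= D).
  { unfold D. rewrite <- Ec, <- Eb. apply asymptotic_dist; [apply Hc | apply Hb | | lra].
    now apply represents_asymptotic with xi. }
  assert (B : d (b' T) (c' T) <= D).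
  { unfold D. rewrite <- Ec', <- Eb', dist_sym.
    apply asymptotic_dist; [apply Hc' | apply Hb' | | lra].
    now apply represents_asymptotic with eta. }
  pose proof (dist_triangle (b T) (c T) (c' T)).
  pose proof (dist_triangle (b' T) (b T) (c' T)).
  eapply Rle_lt_trans.
  { apply (ray_contract c c' t T); [apply Hc | apply Hc' | congruence | lra | lra]. }
  apply Rle_lt_trans with (t * (2 * D + 1) / T).
  - unfold Rdiv. rewrite Rmult_assoc, (Rmult_comm (/ T)), <- Rmult_assoc.
    apply Rmult_le_compat_r; [apply Rlt_le, Rinv_0_lt_compat; lra |].
    apply Rmult_le_compat_l; lra.
  - apply div_lt_of_lt_mult; [lra |].
    replace (t * (2 * D + 1)) with (eps * Q) by (unfold Q; field; lra).
    apply Rmult_lt_compat_l; lra.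
Qed.

(** A single instant in an open set is a cone condition seen from [p]; base change carries it to
    [x0]. *)
Lemma enters_cone_open x0 p O : metric_open d O -> cone_open d x0 (enters p O).
Proof.
  intros HO xi (c & t & Hc & Ec & Ht & Hin).
  destruct (HO _ Hin) as (eps & He & Hball).
  destruct (cone_topology_base_change p x0 t eps Ht He) as (T & HT & H).
  exists T, 1. split; [exact HT |]. split; [lra |].
  intros eta (b & b' & Hb & Eb & Hb' & Eb' & Hlt).
  destruct (represents_from eta p) as (c' & Hc' & Ec').
  exists c', t. repeat split; try apply Hc'; trivial.
  apply Hball. now apply (H xi eta c c' b b').
Qed.

(** * Boundaries of closed convex sets *)

(** Closeness is required at arbitrarily large times, not at all times, so that it can be tested
    along an orbit on the axis. *)
Definition stays_near (F : X -> Prop) (c : R -> X) : Prop :=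
  exists B, forall T, exists t f, T <= t /\ 0 < t /\ F f /\ d (c t) f <= B.

Lemma stays_near_asymptotic F c c' :
  asymptotic d c c' -> stays_near F c -> stays_near F c'.
Proof.
  intros [C HC] [B HB]. exists (C + B). intros T.
  destruct (HB T) as (t & f & H1 & H2 & H3 & H4). exists t, f.
  repeat split; trivial. specialize (HC t ltac:(lra)).
  pose proof (dist_triangle (c t) (c' t) f). rewrite (dist_sym (c' t) (c t)) in *. lra.
Qed.

(** Chords from [c 0] to points of [F] near [c T] lie in [F] and converge to the ray as [T] grows;
    [F] is closed. *)
Lemma near_ray_inside F c t :
  convex d F -> metric_open d (fun x => ~ F x) -> geodesic_ray d c -> F (c 0) ->
  stays_near F c -> 0 <= t -> F (c t).
Proof.
  intros Hconv Hclosed Hc H0 [B HB] Ht. apply NNPP. intros Hn.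
  destruct (Hclosed _ Hn) as (eps & He & Hball).
  set (Q := t * (2 * B) / eps).
  destruct (HB (t + 1 + Rabs B + Rabs Q)) as (T & f & HT & _ & Hf & Hd).
  pose proof (Rle_abs B). pose proof (Rle_abs Q).
  pose proof (Rabs_pos B). pose proof (Rabs_pos Q).
  destruct (geod_exists (c 0) f) as [g Hg].
  pose proof (geod_ray c T Hc ltac:(lra)) as Gc.
  assert (E : d (c 0) (c T) = T) by (rewrite Hc by lra; rewrite Rabs_left1; lra).
  pose proof (dist_triangle f (c 0) (c T)). rewrite (dist_sym f (c T)) in *.
  assert (Htf : 0 <= t <= d (c 0) f) by lra.
  apply (Hball (g t)).
  - rewrite dist_sym. eapply Rle_lt_trans.
    { apply (geod_fellow g c (c 0) f (c T)); trivial; lra. }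
    rewrite E, (dist_sym f (c T)).
    pose proof (dist_nonneg (c T) f).
    apply Rle_lt_trans with (t * (2 * B) / T).
    + unfold Rdiv. rewrite Rmult_assoc, (Rmult_comm (/ T)), <- Rmult_assoc.
      apply Rmult_le_compat_r; [apply Rlt_le, Rinv_0_lt_compat; lra |].
      apply Rmult_le_compat_l; lra.
    + apply div_lt_of_lt_mult; [lra |].
      replace (t * (2 * B)) with (eps * Q) by (unfold Q; field; lra).
      apply Rmult_lt_compat_l; lra.
  - now apply (Hconv (c 0) f g).
Qed.

Lemma bdry_of_near F eta c :
  convex d F -> metric_open d (fun x => ~ F x) -> represents d eta c ->
  stays_near F c -> bdry_of d F eta.
Proof.
  intros Hconv Hclosed Hc Hnear.
  assert (exists p, F p) as [p Hp].
  { destruct Hnear as [B HB]. destruct (HB 0) as (_ & f & _ & _ & Hf & _). eauto. }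
  destruct (represents_from eta p) as (c' & Hc' & E).
  exists c'. split; [exact Hc' |]. intros t Ht.
  apply near_ray_inside; trivial; [apply Hc' | congruence |].
  apply stays_near_asymptotic with c; trivial. now apply represents_asymptotic with eta.
Qed.

(** Seen from a point of [F], being outside the boundary of [F] means that the ray enters the open
    complement. *)
Lemma bdry_of_complement_open x0 F p :
  convex d F -> metric_open d (fun x => ~ F x) -> F p ->
  cone_open d x0 (fun eta => ~ bdry_of d F eta).
Proof.
  intros Hconv Hclosed Hp.
  assert (Hiff : forall eta, ~ bdry_of d F eta <-> enters p (fun x => ~ F x) eta).
  { intros eta. destruct (represents_from eta p) as (c & Hc & E). split.
    - intros Hn. apply NNPP. intros Hno. apply Hn. exists c. split; [exact Hc |].
      intros t Ht. apply NNPP. intros HF. apply Hno. exists c, t. auto.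
    - intros (c1 & t & Hc1 & E1 & Ht & Hout) (c2 & Hc2 & Hin). apply Hout.
      apply near_ray_inside; trivial; [apply Hc1 | congruence |].
      apply stays_near_asymptotic with c2; [now apply represents_asymptotic with eta |].
      exists 0. intros T. exists (Rmax T 1), (c2 (Rmax T 1)).
      pose proof (Rmax_l T 1). pose proof (Rmax_r T 1).
      repeat split; try lra; [apply Hin; lra | rewrite dist_self; lra]. }
  intros xi Hxi. apply Hiff in Hxi.
  destruct (enters_cone_open x0 p _ Hclosed xi Hxi) as (t & e & Ht & He & H).
  exists t, e. repeat split; trivial. intros eta Heta. apply Hiff. auto.
Qed.

(** * Walls *)

(* The half-space decomposition of a reflection, without the reflection, so that
   it can be moved around by isometries. *)
Record wall (F P N : X -> Prop) : Prop := {
  wall_convex : convex d F;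
  wall_convex_pos : convex d P;
  wall_convex_neg : convex d N;
  wall_open_pos : metric_open d P;
  wall_open_neg : metric_open d N;
  wall_cover : forall x, F x \/ P x \/ N x;
  wall_pos_neg : forall x, P x -> N x -> False;
  wall_pos_fix : forall x, P x -> F x -> False;
  wall_neg_fix : forall x, N x -> F x -> False }.

Lemma wall_sym F P N : wall F P N -> wall F N P.
Proof. intros W. split; try apply W; intros x; pose proof (wall_cover _ _ _ W x);
    pose proof (wall_pos_neg _ _ _ W x); tauto. Qed.

Lemma wall_closed F P N : wall F P N -> metric_open d (fun x => ~ F x).
Proof.
  intros W x Hx. destruct (wall_cover _ _ _ W x) as [H | [H | H]]; [easy | |].
  - destruct (wall_open_pos _ _ _ W x H) as (e & He & Hb). exists e. split; trivial.
    intros y Hy. apply Hb in Hy. intros HF. exact (wall_pos_fix _ _ _ W _ Hy HF).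
  - destruct (wall_open_neg _ _ _ W x H) as (e & He & Hb). exists e. split; trivial.
    intros y Hy. apply Hb in Hy. intros HF. exact (wall_neg_fix _ _ _ W _ Hy HF).
Qed.

(** Connectedness of an interval, through the supremum of the times up to which [g] stays in [U]. *)
Lemma geod_connected g x y U V :
  geod_seg d g x y -> metric_open d U -> metric_open d V ->
  (forall t, 0 <= t <= d x y -> U (g t) \/ V (g t)) ->
  (forall t, 0 <= t <= d x y -> U (g t) -> V (g t) -> False) ->
  U x -> U y.
Proof.
  intros Hg HU HV Hcov Hdis Hx.
  set (L := d x y) in *. assert (HL : 0 <= L) by apply dist_nonneg.
  set (E := fun t => 0 <= t <= L /\ forall s, 0 <= s <= t -> U (g s)).
  destruct Hg as (g0 & g1 & Hg). fold L in g1, Hg.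
  assert (E0 : E 0).
  { split; [lra |]. intros s Hs. replace s with 0 by lra. now rewrite g0. }
  destruct (completeness E) as [m [Hub Hlub]].
  { exists L. intros t [Ht _]. lra. }
  { now exists 0. }
  pose proof (Hub 0 E0) as Hm0.
  assert (HmL : m <= L) by (apply Hlub; intros t [Ht _]; lra).
  assert (Hbelow : forall s, 0 <= s < m -> U (g s)).
  { intros s Hs. apply NNPP. intros Hn.
    assert (m <= s); [| lra]. apply Hlub. intros t [Ht HE].
    destruct (Rle_dec t s); [assumption |]. exfalso. apply Hn, HE. lra. }
  assert (HUm : U (g m)).
  { destruct (Hcov m ltac:(lra)) as [H | H]; [exact H | exfalso].
    destruct (HV _ H) as (e & He & Hb).
    destruct (Req_dec m 0) as [-> | Hm].
    { apply (Hdis 0); trivial; [lra | now rewrite g0]. }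
    set (s := Rmax 0 (m - e / 2)).
    assert (Hs : 0 <= s < m /\ m - s < e).
    { unfold s, Rmax. destruct (Rle_dec 0 (m - e / 2)); lra. }
    apply (Hdis s); [lra | apply Hbelow; lra |].
    apply Hb. rewrite Hg by lra. rewrite Rabs_pos_eq; lra. }
  destruct (Req_dec m L) as [-> | Hm]; [now rewrite <- g1 |].
  exfalso. destruct (HU _ HUm) as (e & He & Hb).
  set (u := Rmin L (m + e / 2)).
  assert (Hu : m < u <= L /\ u - m < e).
  { unfold u, Rmin. destruct (Rle_dec L (m + e / 2)); lra. }
  assert (E u); [| pose proof (Hub u ltac:(assumption)); lra].
  split; [lra |]. intros s Hs. destruct (Rlt_dec s m); [apply Hbelow; lra |].
  apply Hb. rewrite Hg by lra. rewrite Rabs_left1; lra.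
Qed.

Lemma wall_cross F P N g x y :
  wall F P N -> geod_seg d g x y -> P x -> N y -> exists t, 0 <= t <= d x y /\ F (g t).
Proof.
  intros W Hg Hx Hy. apply NNPP. intros Hno.
  apply (wall_pos_neg _ _ _ W y); [| exact Hy].
  apply (geod_connected g x y P N); trivial; try apply W.
  - intros t Ht. destruct (wall_cover _ _ _ W (g t)) as [H | H]; [| exact H].
    exfalso. eauto.
  - intros t _. apply W.
Qed.

Lemma wall_same_side F P N g x y :
  wall F P N -> geod_seg d g x y -> (forall t, 0 <= t <= d x y -> ~ F (g t)) ->
  P x -> P y.
Proof.
  intros W Hg Hout Hx. destruct (wall_cover _ _ _ W y) as [H | [H | H]]; trivial.
  - exfalso. pose proof (dist_nonneg x y). apply (Hout (d x y)); [lra |].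
    destruct Hg as (_ & -> & _). exact H.
  - exfalso. destruct (wall_cross F P N g x y) as (t & Ht & HF); trivial.
    exact (Hout t Ht HF).
Qed.

Lemma ray_segment c a b :
  geodesic_ray d c -> 0 <= a <= b -> geod_seg d (fun t => c (a + t)) (c a) (c b).
Proof.
  intros Hc H. pose proof (geod_ray _ (b - a) (ray_shift c a Hc ltac:(lra)) ltac:(lra)) as G.
  cbv beta in G. rewrite Rplus_0_r in G. now replace (a + (b - a)) with b in G by ring.
Qed.

Lemma convex_ray A c a s b :
  convex d A -> geodesic_ray d c -> 0 <= a -> a <= s -> s <= b -> A (c a) -> A (c b) -> A (c s).
Proof.
  intros HA Hc Ha Has Hsb Ia Ib. replace s with (a + (s - a)) by ring.
  apply (HA (c a) (c b) (fun t => c (a + t))); trivial.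
  - apply ray_segment; trivial; lra.
  - rewrite Hc by lra. rewrite Rabs_left1; lra.
Qed.

(** A return to [F] would put [c t] between two points of [F], a return to [P] between two points of
    [P]. *)
Lemma ray_crossed_stays F P N c t s :
  wall F P N -> geodesic_ray d c -> P (c 0) -> 0 <= t -> N (c t) -> t <= s -> N (c s).
Proof.
  intros W Hc H0 Ht HN Hs. destruct (wall_cover _ _ _ W (c s)) as [H | [H | H]]; trivial.
  - exfalso. destruct (wall_cross F P N c (c 0) (c t)) as (u & Hu & HF); trivial.
    { now apply geod_ray. }
    rewrite Hc, Rabs_left1 in Hu by lra.
    apply (wall_neg_fix _ _ _ W (c t)); trivial.
    apply (convex_ray F c u t s); trivial; try lra. apply W.
  - exfalso. apply (wall_pos_neg _ _ _ W (c t)); trivial.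
    apply (convex_ray P c 0 t s); trivial; try lra. apply W.
Qed.

(** Once in [F], the ray cannot return to [P] by convexity nor enter [N], so a tail would lie in
    [F]. *)
Lemma ray_not_crossing F P N eta c :
  wall F P N -> represents d eta c -> P (c 0) -> ~ bdry_of d F eta ->
  (forall t, 0 <= t -> ~ N (c t)) -> forall t, 0 <= t -> P (c t).
Proof.
  intros W Hc H0 Hb HN t Ht. destruct (wall_cover _ _ _ W (c t)) as [H | [H | H]]; trivial;
    [exfalso | now elim (HN t Ht)].
  apply Hb. exists (fun u => c (t + u)). split.
  - apply represents_transfer with c; trivial.
    + apply ray_shift; trivial. apply Hc.
    + exists t. intros u Hu. rewrite (proj1 Hc) by lra. rewrite Rabs_left1; lra.
  - intros u Hu. destruct (wall_cover _ _ _ W (c (t + u))) as [H' | [H' | H']]; trivial; exfalso.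
    + apply (wall_pos_fix _ _ _ W (c t)); trivial.
      apply (convex_ray P c 0 t (t + u)); trivial; try lra; [apply W | apply Hc].
    + apply (HN (t + u)); trivial. lra.
Qed.

(** Segments joining the two rays at equal times have bounded length and cross [F], so the rays stay
    near [F]. *)
Lemma opposite_rays_near F P N eta c b T :
  wall F P N -> represents d eta c -> represents d eta b ->
  (forall t, T <= t -> 0 <= t -> P (c t)) -> (forall t, T <= t -> 0 <= t -> N (b t)) ->
  bdry_of d F eta.
Proof.
  intros W Hc Hb HP HN. apply bdry_of_near with c; trivial; [apply W | eapply wall_closed, W |].
  destruct (represents_asymptotic eta c b Hc Hb) as [C HC].
  exists C. intros T'. set (t := Rmax T' (Rmax T 1)).
  assert (Ht : T' <= t /\ T <= t /\ 1 <= t).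
  { pose proof (Rmax_l T' (Rmax T 1)). pose proof (Rmax_r T' (Rmax T 1)).
    pose proof (Rmax_l T 1). pose proof (Rmax_r T 1). unfold t. lra. }
  destruct (geod_exists (c t) (b t)) as [g Hg].
  destruct (wall_cross F P N g (c t) (b t)) as (u & Hu & HF); trivial;
    [apply HP; lra | apply HN; lra |].
  exists t, (g u). repeat split; trivial; try lra.
  rewrite (geod_dist_start g _ _ u Hg Hu). specialize (HC t ltac:(lra)). lra.
Qed.

(* For [P p] and [N q], the two sides of a wall at infinity are [enters p N] and
   [enters q P]: having the ray from [p] stay in [P] is not visibly an open
   condition, whereas entering an open set is. *)
Lemma enters_dichotomy F P N p q eta :
  wall F P N -> P p -> N q -> ~ bdry_of d F eta -> enters p N eta \/ enters q P eta.
Proof.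
  intros W Hp Hq Hb. apply NNPP. intros Hno. apply Hb.
  destruct (represents_from eta p) as (c & Hc & Ec).
  destruct (represents_from eta q) as (b & Hb' & Eb).
  apply (opposite_rays_near F P N eta c b 0 W Hc Hb').
  - intros t _ Ht. apply (ray_not_crossing F P N eta); trivial; [congruence |].
    intros s Hs HN. apply Hno. left. exists c, s. auto.
  - intros t _ Ht. apply (ray_not_crossing F N P eta); trivial;
      [now apply wall_sym | congruence |].
    intros s Hs HN. apply Hno. right. exists b, s. auto.
Qed.

(** Each ray stays on the side it has entered, so the two asymptotic rays end up on opposite
    sides. *)
Lemma enters_disjoint F P N p q eta :
  wall F P N -> P p -> N q -> enters p N eta -> enters q P eta -> bdry_of d F eta.
Proof.
  intros W Hp Hq (c & t & Hc & Ec & Ht & HN) (b & s & Hb & Eb & Hs & HP).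
  apply (opposite_rays_near F P N eta b c (Rmax s t) W Hb Hc).
  - intros u Hu _. pose proof (Rmax_l s t).
    apply (ray_crossed_stays F N P b s); trivial; try lra;
      [now apply wall_sym | apply Hb | congruence].
  - intros u Hu _. pose proof (Rmax_r s t).
    apply (ray_crossed_stays F P N c t); trivial; try lra; [apply Hc | congruence].
Qed.

Lemma wall_separates x0 F P N p q xi eta V :
  wall F P N -> P p -> N q -> connected_in (cone_open d x0) V ->
  (forall zeta, V zeta -> ~ bdry_of d F zeta) ->
  V xi -> V eta -> enters p N eta -> ~ enters p N xi -> False.
Proof.
  intros W Hp Hq HV Hmiss Hxi Heta He Hne. apply HV.
  exists (enters p N), (enters q P). repeat split.
  - apply enters_cone_open, W.
  - apply enters_cone_open, W.
  - intros z Hz. apply (enters_dichotomy F); auto.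
  - eauto.
  - exists xi. split; trivial.
    destruct (enters_dichotomy F P N p q xi); auto. contradiction.
  - intros z Hz H H'. apply (Hmiss z Hz). now apply (enters_disjoint F P N p q).
Qed.

(** * Transport of walls by isometries *)

Definition image (f : X -> X) (A : X -> Prop) (y : X) : Prop := exists x, A x /\ f x = y.

Lemma isometry_injective f x y : isometry d f -> f x = f y -> x = y.
Proof.
  intros [Hf _] E. apply dist_zero. rewrite <- Hf, E, dist_self. lra.
Qed.

Lemma image_convex f A : isometry d f -> convex d A -> convex d (image f A).
Proof.
  intros Hf HA x' y' g (x & Hx & <-) (y & Hy & <-) Hg t Ht.
  destruct (geod_exists x y) as [h Hh].
  pose proof (geod_isometry f h x y Hf Hh) as Hh'.
  exists (h t). split.
  - apply (HA x y); trivial. now rewrite <- (proj1 Hf).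
  - apply (geod_unique _ g _ _ t Hh' Hg Ht).
Qed.

Lemma image_open f A : isometry d f -> metric_open d A -> metric_open d (image f A).
Proof.
  intros Hf HA x' (x & Hx & <-). destruct (HA x Hx) as (e & He & Hb).
  exists e. split; trivial. intros y' Hy.
  destruct (proj2 Hf y') as [y <-]. rewrite (proj1 Hf) in Hy. exists y. auto.
Qed.

Lemma image_disjoint f A B x :
  isometry d f -> (forall x, A x -> B x -> False) -> image f A x -> image f B x -> False.
Proof.
  intros Hf H (a & Ha & Ea) (b & Hb & Eb).
  rewrite <- Eb in Ea. apply (isometry_injective f) in Ea; trivial. subst. eauto.
Qed.

Lemma wall_image f F P N :
  isometry d f -> wall F P N -> wall (image f F) (image f P) (image f N).
Proof.
  intros Hf W. split; try (apply image_convex; trivial; apply W);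
    try (apply image_open; trivial; apply W);
    try (intros x; apply image_disjoint; trivial; apply W).
  intros y. destruct (proj2 Hf y) as [x <-].
  destruct (wall_cover _ _ _ W x) as [H | [H | H]];
    [left | right; left | right; right]; exists x; auto.
Qed.

Lemma isometry_iter f n : isometry d f -> isometry d (Nat.iter n f).
Proof.
  intros [H1 H2]. induction n as [| n [I1 I2]]; simpl.
  - split; trivial. intros y. now exists y.
  - split.
    + intros x y. rewrite !Nat.iter_succ, H1. apply I1.
    + intros y. destruct (H2 y) as [z <-]. destruct (I2 z) as [x <-].
      exists x. apply Nat.iter_succ.
Qed.


(** * Axes of hyperbolic isometries *)

(** For the midpoint [m] of [y] and [f y], contraction from [f y] gives
    [d m (f m) <= d y (f (f y)) / 2]. *)
Lemma displacement_double f L y :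
  isometry d f -> (forall z, L <= d z (f z)) -> 2 * L <= d y (f (f y)).
Proof.
  intros Hf HL. destruct (geod_exists y (f y)) as [h Hh].
  pose proof (geod_contract _ _ _ _ _ (1 / 2) (geod_reverse _ _ _ Hh)
                (geod_isometry f h _ _ Hf Hh) ltac:(lra)) as B.
  cbv beta in B. rewrite (proj1 Hf), (dist_sym (f y) y) in B.
  replace (d y (f y) - 1 / 2 * d y (f y)) with (1 / 2 * d y (f y)) in B by lra.
  pose proof (HL (h (1 / 2 * d y (f y)))). lra.
Qed.

Lemma displacement_pow2 f L k y :
  isometry d f -> (forall z, L <= d z (f z)) ->
  2 ^ k * L <= d y (Nat.iter (2 ^ k) f y).
Proof.
  intros Hf HL. revert y. induction k as [| k IH]; intros y.
  - simpl. rewrite Rmult_1_l. apply HL.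
  - replace (2 ^ S k)%nat with (2 ^ k + 2 ^ k)%nat by (simpl; lia).
    rewrite Nat.iter_add. simpl pow. rewrite Rmult_assoc.
    apply (displacement_double (Nat.iter (2 ^ k) f)); trivial. now apply isometry_iter.
Qed.

Lemma iter_dist_le f x n :
  isometry d f -> d x (Nat.iter n f x) <= INR n * d x (f x).
Proof.
  intros Hf. induction n as [| n IH].
  - simpl. rewrite dist_self. lra.
  - rewrite S_INR, Nat.iter_succ_r.
    pose proof (dist_triangle (Nat.iter n f x) x (Nat.iter n f (f x))).
    rewrite (proj1 (isometry_iter f n Hf)) in *. lra.
Qed.

(** The lower bound is known for powers of two. With [m = 2 ^ n > n], going from the [n]-th to the
    [m]-th iterate costs at most [(m - n) * l], which leaves at least [n * l] for the first part. *)
Lemma axis_dist f x l n :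
  isometry d f -> (forall z, l <= d z (f z)) -> d x (f x) = l ->
  d x (Nat.iter n f x) = INR n * l.
Proof.
  intros Hf Hl Hx. apply Rle_antisym.
  - rewrite <- Hx. now apply iter_dist_le.
  - pose proof (displacement_pow2 f l n x Hf Hl) as A.
    assert (Hn : (n < 2 ^ n)%nat) by (apply Nat.pow_gt_lin_r; lia).
    set (m := (2 ^ n)%nat) in *.
    assert (Em : 2 ^ n = INR m) by (unfold m; now rewrite pow_INR).
    pose proof (dist_triangle (Nat.iter n f x) x (Nat.iter m f x)).
    assert (Es : Nat.iter m f x = Nat.iter n f (Nat.iter (m - n) f x)).
    { rewrite <- Nat.iter_add. f_equal. lia. }
    rewrite Es, (proj1 (isometry_iter f n Hf)), <- Es in H.
    pose proof (iter_dist_le f x (m - n) Hf) as B.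
    rewrite minus_INR, Hx in B by lia. rewrite Em in A. lra.
Qed.

(** Equality in the triangle inequality puts each iterate on the segment from [x] to any later one.
    These segments are nested, and the ray is read at time [t] from one that is long enough. *)
Lemma axis_ray f x l :
  isometry d f -> (forall z, l <= d z (f z)) -> d x (f x) = l -> 0 < l ->
  exists c, geodesic_ray d c /\ forall n, c (INR n * l) = Nat.iter n f x.
Proof.
  intros Hf Hl Hx Hpos.
  assert (Hdist : forall n, d x (Nat.iter n f x) = INR n * l) by (intros; now apply axis_dist).
  set (s := fun n : nat => proj1_sig
    (constructive_indefinite_description _ (geod_exists x (Nat.iter n f x)))).
  assert (Hs : forall n, geod_seg d (s n) x (Nat.iter n f x)).
  { intros n. unfold s. now destruct constructive_indefinite_description. }
  clearbody s.
  assert (Hon : forall n m, (n <= m)%nat -> s m (INR n * l) = Nat.iter n f x).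
  { intros n m Hnm. rewrite <- Hdist.
    apply (geod_through (s m) _ _ (Nat.iter m f x)); trivial.
    assert (Es : Nat.iter m f x = Nat.iter n f (Nat.iter (m - n) f x)).
    { rewrite <- Nat.iter_add. f_equal. lia. }
    rewrite Es at 1.
    rewrite (proj1 (isometry_iter f n Hf)), !Hdist, minus_INR by lia. lra. }
  assert (Hcoh : forall n m t, (n <= m)%nat -> 0 <= t <= INR n * l -> s n t = s m t).
  { intros n m t Hnm Ht.
    apply (geod_unique _ _ x (Nat.iter n f x)); trivial; [| now rewrite Hdist].
    rewrite <- (Hon n m Hnm). apply geod_restrict with (Nat.iter m f x); trivial.
    rewrite Hdist. apply le_INR in Hnm. nra. }
  assert (Hbig : forall t, exists n, t <= INR n * l).
  { intros t. destruct (INR_archimed l t Hpos) as [n Hn]. exists n. lra. }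
  set (k := fun t => proj1_sig (constructive_indefinite_description _ (Hbig t))).
  assert (Hk : forall t, t <= INR (k t) * l).
  { intros t. unfold k. now destruct constructive_indefinite_description. }
  clearbody k.
  exists (fun t => s (k t) t). split.
  - intros t u Ht Hu. set (m := Nat.max (k t) (k u)).
    rewrite (Hcoh (k t) m t), (Hcoh (k u) m u) by (try lia; split; auto).
    apply Hs; rewrite Hdist.
    + split; trivial. apply Rle_trans with (INR (k t) * l); trivial.
      apply Rmult_le_compat_r; [lra |]. apply le_INR. lia.
    + split; trivial. apply Rle_trans with (INR (k u) * l); trivial.
      apply Rmult_le_compat_r; [lra |]. apply le_INR. lia.
  - intros n. pose proof (Hk (INR n * l)). pose proof (pos_INR n).
    rewrite (Hcoh _ (Nat.max n (k (INR n * l)))) by (try lia; split; nra).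
    apply Hon. lia.
Qed.

(** This makes hypothesis (1) applicable to the class of the axis ray. *)
Lemma axis_gamma_infty f x l c xi :
  isometry d f -> 0 < l -> represents d xi c ->
  (forall n, c (INR n * l) = Nat.iter n f x) -> is_gamma_infty d f xi.
Proof.
  intros Hf Hl Hc Hit x0 t eps Ht He.
  destruct (represents_from xi x0) as (b & Hb & Eb).
  set (D := d x x0). assert (D0 : 0 <= D) by apply dist_nonneg.
  assert (c0 : c 0 = x) by (specialize (Hit 0%nat); simpl in Hit; now rewrite Rmult_0_l in Hit).
  (* Twice the distance [2 * D] from [b T] to the iterate of [x0]: one [D] for the asymptotic rays,
     one for the two orbits. *)
  set (Q := t * (4 * D) / eps).
  assert (Q0 : 0 <= Q) by (apply div_nonneg; nra).
  destruct (INR_archimed l (t + 2 * D + 1 + Q) Hl) as [N HN].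
  exists N. intros n Hn. set (T := INR n * l).
  assert (HT : t + 2 * D + 1 + Q < T).
  { unfold T. apply le_INR in Hn. nra. }
  set (u := Nat.iter n f x0).
  assert (Hu : d (b T) u <= 2 * D).
  { pose proof (asymptotic_dist b c T (proj1 Hb) (proj1 Hc)
                  (represents_asymptotic xi b c Hb Hc) ltac:(lra)) as A.
    rewrite Eb, c0, (dist_sym x0 x) in A. fold D in A.
    pose proof (dist_triangle (c T) (b T) u) as B.
    unfold T, u in B. rewrite Hit, (proj1 (isometry_iter f n Hf)) in B.
    fold T u D in B. rewrite <- Hit in B. fold T in B. lra. }
  pose proof (geod_ray b T (proj1 Hb) ltac:(lra)) as Gb.
  assert (E : d (b 0) (b T) = T) by (rewrite (proj1 Hb) by lra; rewrite Rabs_left1; lra).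
  rewrite Eb in Gb, E.
  pose proof (dist_triangle u x0 (b T)). rewrite (dist_sym u (b T)) in *.
  split; [lra |].
  destruct (geod_exists x0 u) as [g Hg].
  exists g, b. repeat split; trivial; try apply Hg; try apply Hb.
  eapply Rle_lt_trans.
  { apply (geod_fellow g b x0 u (b T)); trivial; lra. }
  rewrite E, (dist_sym u (b T)).
  apply Rle_lt_trans with (t * (4 * D) / T).
  - unfold Rdiv. rewrite Rmult_assoc, (Rmult_comm (/ T)), <- Rmult_assoc.
    apply Rmult_le_compat_r; [apply Rlt_le, Rinv_0_lt_compat; lra |].
    apply Rmult_le_compat_l; lra.
  - apply div_lt_of_lt_mult; [lra |].
    replace (t * (4 * D)) with (eps * Q) by (unfold Q; field; lra).
    apply Rmult_lt_compat_l; lra.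
Qed.

(** The path from [g s] to [f (g s)] through [f z] has length [l], so the segment consists of points
    of minimal displacement. *)
Lemma min_segment_avoids f F l z g s :
  isometry d f -> (forall y, l <= d y (f y)) -> (forall y, d y (f y) = l -> ~ F y) ->
  d z (f z) = l -> geod_seg d g z (f z) -> 0 <= s <= d z (f z) -> ~ F (g s).
Proof.
  intros Hf Hl Havoid Hz Hg Hs. apply Havoid. apply Rle_antisym; [| apply Hl].
  pose proof (dist_triangle (f z) (g s) (f (g s))) as A.
  rewrite (proj1 Hf) in A.
  rewrite (geod_dist_end g _ _ s Hg Hs), (geod_dist_start g _ _ s Hg Hs) in A. lra.
Qed.

Lemma min_same_side f F P N l z n :
  isometry d f -> wall F P N -> (forall y, l <= d y (f y)) ->
  (forall y, d y (f y) = l -> ~ F y) -> d z (f z) = l ->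
  P z <-> P (Nat.iter n f z).
Proof.
  intros Hf W Hl Havoid Hz.
  (* Quantified over both sides, because the backward implication applies it to [N]. *)
  assert (step : forall P N z, wall F P N -> d z (f z) = l -> P z -> P (f z)).
  { clear z Hz. intros P' N' z W' Hz Hin. destruct (geod_exists z (f z)) as [g Hg].
    apply (wall_same_side F P' N' g z); trivial.
    intros t Ht. now apply (min_segment_avoids f F l z). }
  revert z Hz. induction n as [| n IH]; intros z Hz; [reflexivity |].
  rewrite Nat.iter_succ_r, <- IH by (now rewrite (proj1 Hf)).
  split; [now apply (step P N) |]. intros H.
  destruct (wall_cover _ _ _ W z) as [H' | [H' | H']]; trivial; exfalso.
  - now apply (Havoid z).
  - apply (wall_pos_neg _ _ _ W (f z)); trivial. apply (step N P); trivial. now apply wall_sym.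
Qed.

Lemma maps_bdry_into_iter f F n c :
  isometry d f -> maps_bdry_into d f F -> geodesic_ray d c -> (forall t, 0 <= t -> F (c t)) ->
  exists c', geodesic_ray d c' /\ asymptotic d (fun t => Nat.iter n f (c t)) c' /\
    forall t, 0 <= t -> F (c' t).
Proof.
  intros Hf HF Hc Hin. induction n as [| n (c' & Hc' & Ha & Hin')].
  - exists c. repeat split; trivial. exists 0. intros. simpl. rewrite dist_self. lra.
  - destruct (HF c' Hc') as (c2 & Hc2 & Ha2 & Hin2).
    { exists c'. repeat split; trivial. exists 0. intros. rewrite dist_self. lra. }
    exists c2. repeat split; trivial.
    apply asymptotic_trans with (fun t => f (c' t)); trivial.
    destruct Ha as [C HC]. exists C. intros t Ht.
    rewrite Nat.iter_succ, (proj1 Hf). auto.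
Qed.

(** The ray is pulled back into [F] by choosing preimages, then pushed forward by iterating the
    hypothesis on the boundary. *)
Lemma bdry_of_image_iter f F n eta :
  isometry d f -> maps_bdry_into d f F ->
  bdry_of d (image (Nat.iter n f) F) eta -> bdry_of d F eta.
Proof.
  intros Hf HF (c & Hc & Hin).
  pose proof (isometry_iter f n Hf) as Hfn.
  set (c0 := fun t =>
    proj1_sig (constructive_indefinite_description _ (proj2 Hfn (c t)))).
  assert (E : forall t, Nat.iter n f (c0 t) = c t).
  { intros t. unfold c0. now destruct constructive_indefinite_description. }
  clearbody c0.
  destruct (maps_bdry_into_iter f F n c0) as (c' & Hc' & Ha & Hin'); trivial.
  - intros s t Hs Ht. rewrite <- (proj1 Hfn), !E. now apply Hc.
  - intros t Ht. destruct (Hin t Ht) as (z & Hz & Ez). rewrite <- E in Ez.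
    apply (isometry_injective (Nat.iter n f)) in Ez; trivial. now subst.
  - exists c'. split; trivial. apply represents_transfer with c; trivial.
    destruct Ha as [C HC]. exists C. intros t Ht. rewrite <- E. auto.
Qed.

(** * Failure of local connectedness *)

Lemma wall_not_locally_connected f r F P N x l x0 :
  isometry d f -> isometry d r -> wall F P N -> almost_extendible d ->
  (forall z, F z -> r z = z) -> (forall z, P z -> N (r z)) ->
  (forall xi, is_gamma_infty d f xi -> ~ bdry_of d F xi) -> maps_bdry_into d f F ->
  (forall z, l <= d z (f z)) -> 0 < l -> d x (f x) = l ->
  (forall z, d z (f z) = l -> ~ F z) -> P x -> ~ locally_connected (cone_open d x0).
Proof.
  intros Hf Hr W (M & HM & Hext) HrF HrP Hinf Hmaps Hl Hpos Hx Havoid HxP Hlc.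
  destruct (axis_ray f x l Hf Hl Hx Hpos) as (a & Ha & Hit).
  assert (a0 : a 0 = x) by (specialize (Hit 0%nat); simpl in Hit; now rewrite Rmult_0_l in Hit).
  destruct (ray_represents a Ha) as [xi Hxi].
  assert (Hnot : ~ bdry_of d F xi).
  { apply Hinf. now apply (axis_gamma_infty f x l a). }
  (* [r] fixes [F] pointwise and preserves distances, so a reflected orbit point is as far from [F]
     as the original; if none were deep, the axis would stay within [M] of [F]. *)
  assert (deep : exists y, N y /\ forall z, F z -> M < d y z).
  { apply NNPP. intros Hno. apply Hnot.
    apply bdry_of_near with a; trivial; [apply W | eapply wall_closed, W |].
    exists M. intros T.
    destruct (INR_archimed l (Rmax T 0) Hpos) as [n Hn].
    pose proof (Rmax_l T 0). pose proof (Rmax_r T 0).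
    exists (INR n * l). apply NNPP. intros Hfar. apply Hno.
    exists (r (Nat.iter n f x)). split.
    - apply HrP. now apply (min_same_side f F P N l).
    - intros z Hz. apply Rnot_le_lt. intros Hle. apply Hfar.
      exists z. repeat split; trivial; try lra.
      now rewrite Hit, <- (proj1 Hr), (HrF z). }
  destruct deep as (y & Hy & Hdeep).
  assert (exists p, F p) as [p Hp].
  { destruct (geod_exists x y) as [g Hg].
    destruct (wall_cross F P N g x y) as (t & _ & HF); eauto. }
  destruct (Hlc xi (fun eta => ~ bdry_of d F eta)) as (V & HVo & HVxi & HVU & HVc); trivial.
  { apply bdry_of_complement_open with p; trivial; [apply W | eapply wall_closed, W]. }
  destruct (HVo xi HVxi) as (t & eps & Ht & He & HV).
  destruct (cone_topology_base_change x0 x t eps ltac:(lra) He) as (T & HT & Hbase).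
  set (B := d x y + M). assert (HB : 0 < B) by (unfold B; pose proof (dist_nonneg x y); lra).
  (* With [S = n * l], the time [s] differs from [S] by at most [B], hence exceeds [T], and the
     fellow-travelling bound [T * (2 * B) / S] is below 1. *)
  destruct (INR_archimed l (T + B + T * (2 * B)) Hpos) as [n Hn].
  pose proof (isometry_iter f n Hf) as Hfn.
  pose proof (wall_image _ _ _ _ Hfn W) as Wn.
  (* For [m < n] the preimage [z] is a backward iterate of [x]; it still has displacement [l], so it
     lies on the side of [x]. *)
  assert (side : forall m, image (Nat.iter n f) P (Nat.iter m f x)).
  { intros m. destruct (proj2 Hfn (Nat.iter m f x)) as [z Hz]. exists z. split; trivial.
    apply (min_same_side f F P N l z n); trivial.
    - rewrite <- (proj1 Hfn (z)), <- Nat.iter_succ_r, Nat.iter_succ, Hz.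
      rewrite <- Nat.iter_succ, Nat.iter_succ_r.
      now rewrite (proj1 (isometry_iter f m Hf)).
    - rewrite Hz. now apply (min_same_side f F P N l x m). }
  destruct (Hext x (Nat.iter n f y)) as (c & Hc & Ec & s & Hs & Hclose).
  destruct (ray_represents c Hc) as [eta Heta].
  (* The segment from the translate of [y] to [c s] has length at most [M], too short to reach the
     translated wall. *)
  assert (Hin : image (Nat.iter n f) N (c s)).
  { destruct (geod_exists (Nat.iter n f y) (c s)) as [g Hg].
    apply (wall_same_side _ _ _ g (Nat.iter n f y) _ (wall_sym _ _ _ Wn)); trivial.
    - intros u Hu (z & Hz & Ez). specialize (Hdeep z Hz).
      pose proof (geod_dist_start g _ _ u Hg Hu) as E.
      rewrite <- Ez, (proj1 Hfn) in E. rewrite (dist_sym (Nat.iter n f y)) in Hu. lra.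
    - exists y. auto. }
  assert (HVeta : V eta).
  { apply HV.
    destruct (represents_from xi x0) as (b & Hb & Eb).
    destruct (represents_from eta x0) as (b' & Hb' & Eb').
    exists b, b'. repeat split; trivial; try apply Hb; try apply Hb'.
    apply (Hbase xi eta b b' a c); trivial.
    set (S := INR n * l) in *.
    assert (HT2B : 0 <= T * (2 * B)) by nra.
    assert (HS : d (c s) (a S) <= B).
    { unfold S. rewrite Hit.
      pose proof (dist_triangle (Nat.iter n f y) (c s) (Nat.iter n f x)) as A.
      rewrite (proj1 Hfn), (dist_sym y x) in A. unfold B. lra. }
    pose proof (geod_ray a S Ha ltac:(lra)) as Ga. rewrite a0 in Ga.
    pose proof (geod_ray c s Hc Hs) as Gc. rewrite Ec in Gc.
    assert (Ea : d x (a S) = S) by (rewrite <- a0, Ha by lra; rewrite Rabs_left1; lra).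
    assert (Es : d x (c s) = s) by (rewrite <- Ec, Hc by lra; rewrite Rabs_left1; lra).
    pose proof (dist_triangle (c s) x (a S)).
    rewrite dist_sym. eapply Rle_lt_trans.
    { apply (geod_fellow c a x (c s) (a S)); trivial; lra. }
    rewrite Ea. apply Rle_lt_trans with (T * (2 * B) / S).
    - unfold Rdiv. rewrite Rmult_assoc, (Rmult_comm (/ S)), <- Rmult_assoc.
      apply Rmult_le_compat_r; [apply Rlt_le, Rinv_0_lt_compat; lra |].
      apply Rmult_le_compat_l; lra.
    - apply div_lt_of_lt_mult; lra. }
  apply (wall_separates x0 _ _ _ x (Nat.iter n f y) xi eta V Wn); trivial.
  - apply (side 0%nat).
  - exists y. auto.
  - intros zeta Hz Hbd. apply (HVU zeta Hz). now apply (bdry_of_image_iter f F n).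
  - exists c, s. auto.
  (* The ray of [xi] from [x] is the axis; past the translated wall it would stay there, against
     later orbit points. *)
  - intros (b & u & Hb & Eb & Hu & HN).
    rewrite (represents_unique xi b a u Hb Hxi ltac:(congruence) Hu) in HN.
    destruct (INR_archimed l u Hpos) as [m Hm].
    apply (wall_pos_neg _ _ _ Wn (a (INR m * l))).
    + rewrite Hit. apply side.
    + apply (ray_crossed_stays _ _ _ a u _ Wn); trivial; [| lra].
      rewrite a0. apply (side 0%nat).
Qed.

(** * Reflections give walls *)

Lemma isometry_fix_convex r : isometry d r -> convex d (Fix r).
Proof.
  intros Hr x y g Hx Hy Hg t Ht. pose proof (geod_isometry r g x y Hr Hg) as G.
  unfold Fix in *. rewrite Hx, Hy in G.
  apply (geod_unique _ g x y t G Hg Ht).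
Qed.

Lemma isometry_fix_closed r : isometry d r -> metric_open d (fun x => ~ Fix r x).
Proof.
  intros Hr x Hx. exists (d x (r x) / 2). split.
  - pose proof (dist_nonneg x (r x)).
    destruct (Req_dec (d x (r x)) 0) as [E | E]; [| lra].
    exfalso. apply Hx. symmetry. apply dist_zero. lra.
  - intros y Hy HF. unfold Fix in HF.
    pose proof (dist_triangle y x (r x)) as A.
    rewrite <- HF in A at 2. rewrite (proj1 Hr), (dist_sym y x) in A. lra.
Qed.

Lemma connected_geod g x y : geod_seg d g x y ->
  connected_in (metric_open d) (fun z => exists t, 0 <= t <= d x y /\ z = g t).
Proof.
  intros Hg (U & V & HU & HV & Hcov & (u & (s & Hs & ->) & Hu) & (v & (t & Ht & ->) & Hv) & Hdis).
  assert (Hdis' : forall w, 0 <= w <= d x y -> U (g w) -> V (g w) -> False) by eauto.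
  assert (Hcov' : forall w, 0 <= w <= d x y -> U (g w) \/ V (g w)) by eauto.
  assert (Ex : g 0 = x) by apply Hg. assert (Ey : g (d x y) = y) by apply Hg.
  destruct (Hcov' 0) as [H | H]; [lra | |]; rewrite Ex in H.
  - apply (Hdis' t Ht); trivial.
    pose proof (geod_restrict g x y t Hg Ht) as Gt.
    apply (geod_connected g x (g t) U V Gt); trivial;
      intros w Hw; rewrite (geod_dist_start g x y t Hg Ht) in Hw; auto with real.
    + apply Hcov'; lra.
    + apply Hdis'; lra.
  - apply (Hdis' s Hs); trivial.
    pose proof (geod_restrict g x y s Hg Hs) as Gs.
    apply (geod_connected g x (g s) V U Gs); trivial;
      intros w Hw; rewrite (geod_dist_start g x y s Hg Hs) in Hw.
    + destruct (Hcov' w ltac:(lra)); auto.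
    + intros HA HB. apply (Hdis' w); trivial. lra.
Qed.

Lemma connected_union_point x (S : (X -> Prop) -> Prop) :
  (forall D, S D -> D x /\ connected_in (metric_open d) D) ->
  connected_in (metric_open d) (fun z => exists D, S D /\ D z).
Proof.
  intros HS (U & V & HU & HV & Hcov & (u & (D & HD & Du) & Hu) & (v & (E & HE & Ev) & Hv) & Hdis).
  destruct (HS D HD) as [Dx Dc]. destruct (HS E HE) as [Ex Ecn].
  destruct (Hcov x) as [H | H]; [eauto | |].
  - apply Ecn. exists U, V. repeat split; eauto.
  - apply Dc. exists U, V. repeat split; eauto.
Qed.

(** The union of all connected subsets of [Y] through [x]. It is needed to see that the two
    components of a reflection exhaust the complement of the fixed set. *)
Lemma component_exists (Y : X -> Prop) x :
  Y x -> exists C, is_component d Y C /\ C x.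
Proof.
  intros Hx.
  set (S := fun D : X -> Prop =>
    (D x /\ connected_in (metric_open d) D) /\ forall z, D z -> Y z).
  set (C := fun z => exists D, S D /\ D z).
  assert (Cx : C x).
  { exists (eq x). split; [| reflexivity]. repeat split.
    - intros (U & V & _ & _ & _ & (u & <- & Hu) & (v & <- & Hv) & H). eauto.
    - now intros z <-. }
  assert (Cc : connected_in (metric_open d) C).
  { apply (connected_union_point x). intros D HD. apply HD. }
  exists C. split; [| exact Cx]. repeat split.
  - intros z (D & HD & Dz). now apply HD.
  - eauto.
  - exact Cc.
  - intros D HD Dc (w & Cw & Dw) z Dz.
    exists (fun u => C u \/ D u). split; [| auto]. split; [split; [auto |] |].
    + intros (U & V & HU & HV & Hcov & (u & Iu & Hu) & (v & Iv & Hv) & Hdis).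
      assert (mono : forall A, connected_in (metric_open d) A ->
                (forall a, A a -> C a \/ D a) ->
                forall a b, A a -> A b -> U a -> V b -> False).
      { intros A HA Hsub a b Aa Ab Ha Hb. apply HA. exists U, V. repeat split; eauto. }
      (* The common point [w] lies in [U] or [V]; paired with [v] or [u] respectively, it splits [C]
         or [D]. *)
      destruct (Hcov w (or_introl Cw)) as [Hw | Hw], Iu as [Iu | Iu], Iv as [Iv | Iv];
        first [ now apply (mono C Cc (fun a h => or_introl h) u v)
              | now apply (mono D Dc (fun a h => or_intror h) u v)
              | now apply (mono C Cc (fun a h => or_introl h) u w)
              | now apply (mono D Dc (fun a h => or_intror h) u w)
              | now apply (mono C Cc (fun a h => or_introl h) w v)
              | now apply (mono D Dc (fun a h => or_intror h) w v) ].
    + intros u [(E & HE & Eu) | Du]; [now apply HE | auto].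
Qed.

(** A geodesic from the centre of a ball stays in the ball, so maximality absorbs it into the
    component. *)
Lemma component_open (Y C : X -> Prop) :
  metric_open d Y -> is_component d Y C -> metric_open d C.
Proof.
  intros HY (Hsub & _ & _ & Hmax) x Cx. destruct (HY x (Hsub x Cx)) as (e & He & Hb).
  exists e. split; trivial. intros y Hy. destruct (geod_exists x y) as [g Hg].
  pose proof (dist_nonneg x y).
  apply (Hmax (fun z => exists t, 0 <= t <= d x y /\ z = g t)).
  - intros z (t & Ht & ->). apply Hb. rewrite (geod_dist_start g x y t Hg Ht). lra.
  - now apply connected_geod.
  - exists x. split; trivial. exists 0. split; [lra |]. symmetry. apply Hg.
  - exists (d x y). split; [lra |]. symmetry. apply Hg.
Qed.

Lemma reflection_wall r :
  reflection d r -> exists P N, wall (Fix r) P N /\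
    (forall z, P z -> N (r z)) /\ (forall z, N z -> P (r z)).
Proof.
  intros (Hr & Hinv & P & N & (x & HPx & HNx) & Hcomp & HP & HN & HPc & HNc & Hswap).
  pose proof (isometry_fix_closed r Hr) as Hclosed.
  exists P, N. split; [split; trivial | split].
  - now apply isometry_fix_convex.
  - eapply component_open; eauto.
  - eapply component_open; eauto.
  - intros z. destruct (classic (Fix r z)) as [H | H]; [auto | right].
    destruct (component_exists (fun z => ~ Fix r z) z H) as (C & HC & Cz).
    apply Hcomp in HC as [E | E]; apply E in Cz; auto.
  (* If the two components met, maximality of [N] would absorb all of [P], including [x]. *)
  - intros z HPz HNz. apply HNx.
    apply (proj2 (proj2 (proj2 HN)) P); trivial; [apply HP | apply HP | eauto].
  - intros z HPz. now apply HP.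
  - intros z HNz. now apply HN.
  - intros z Hz. apply Hswap. eauto.
  - intros z Hz. apply Hswap in Hz as (w & Hw & <-). now rewrite Hinv.
Qed.

End Proper.
End CAT0.

Theorem theorem1p1 (X : Type) (d : X -> X -> R) (gam r : X -> X)
  (Hcat : CAT0 d) (Hprop : proper d) (Hae : almost_extendible d)
  (Hgam : hyperbolic d gam) (Hr : reflection d r)
  (H1 : forall xi : bdry d, is_gamma_infty d gam xi -> ~ bdry_of d (Fix r) xi)
  (H2 : maps_bdry_into d gam (Fix r))
  (H3 : forall x, Min d gam x -> ~ Fix r x) :
  forall x0 : X, ~ locally_connected (cone_open d x0).
Proof.
  intros x0. destruct Hgam as (Hf & (x & l & [Hle Hgreatest] & Hx) & l' & [Hle' _] & Hpos).
  (* [x] realises [l] while positivity is given for [l']; [l] is the greatest lower bound of the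
     displacements. *)
  assert (Hl : 0 < l) by (pose proof (Hgreatest l' Hle'); lra).
  assert (Havoid : forall z, d z (gam z) = l -> ~ Fix r z).
  { intros z Hz. apply H3. exists l. repeat split; trivial. }
  destruct (reflection_wall Hcat r Hr) as (P & N & W & HPN & HNP).
  destruct (wall_cover _ _ _ W x) as [H | [H | H]].
  - now elim (Havoid x Hx).
  - apply (wall_not_locally_connected Hcat Hprop gam r (Fix r) P N x l); trivial. apply Hr.
  - apply (wall_not_locally_connected Hcat Hprop gam r (Fix r) N P x l); trivial.
    + apply Hr.
    + now apply wall_sym.
Qed.
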